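(* Let $\Theta\subseteq\mathbb{R}^d$ be a set of parameters. Assume that $\Theta'\subseteq\Theta$ is a compact set which is not a singleton, and that $P_\theta$, $\theta\in\Theta'$, is a collection of probability distributions on some measurable space $\mathcal{X}$ which are absolutely continuous with respect to one another. Let $\mathbf{X}\sim P_\theta$ be a random variable taking values in $\mathcal{X}$. Then there exists no unbiased estimator $g(\mathbf{X})$ for $\theta$ which is measurable with respect to the Lebesgue $\sigma$-algebra and whose range is $\Theta'$.
   Context: An estimator whose range is $\Theta'$ is a measurable function $g:\mathcal{X}\to\Theta'\subseteq\mathbb{R}^d$, i.e. all its values lie in $\Theta'$ (measurability is with respect to the Lebesgue $\sigma$-algebra on $\mathbb{R}^d$). It is unbiased if for every $\theta\in\Theta'$ the expectation exists and $\mathbb{E}_{P_\theta}(g(\mathbf{X}))=\int_{\mathcal{X}} g\,dP_\theta=\theta$. The distributions are absolutely continuous with respect to one another if any two of them have the same null sets. *)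

(* Defs.v *)
From HB Require Import structures.
From mathcomp Require Import all_boot all_order all_algebra.
From mathcomp Require Import all_classical all_reals all_analysis.

Set Implicit Arguments.
Unset Strict Implicit.
Unset Printing Implicit Defensive.
Import Order.TTheory GRing.Theory Num.Theory.
Import numFieldNormedType.Exports.

Local Open Scope classical_set_scope.
Local Open Scope ring_scope.
Local Open Scope ereal_scope.

Section lebesgue_sigma_algebra.
Context (R : realType) (d : nat).

Definition box (ab : 'rV[R]_d * 'rV[R]_d) : set 'rV[R]_d :=
  [set x | forall i, (ab.1 ord0 i < x ord0 i <= ab.2 ord0 i)%R].

Definition box_volume (ab : 'rV[R]_d * 'rV[R]_d) : \bar R :=
  (\prod_(i < d) Num.max 0 (ab.2 ord0 i - ab.1 ord0 i))%:E.

(* Covers are countable sets of boxes rather than sequences, so that the empty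
   set has the empty cover: in dimension 0 the only box is the whole space and
   it has volume 1. *)
Definition box_cover (A : set 'rV[R]_d) : set (set ('rV[R]_d * 'rV[R]_d)) :=
  [set D | countable D /\ A `<=` \bigcup_(ab in D) box ab].

Definition lebesgue_outer_measure (A : set 'rV[R]_d) : \bar R :=
  ereal_inf [set \esum_(ab in D) box_volume ab | D in box_cover A].

Lemma box_volume_ge0 ab : 0 <= box_volume ab.
Proof. by rewrite lee_fin prodr_ge0// => i _; rewrite le_max lexx. Qed.

Lemma lebesgue_outer_measure_ge0 A : 0 <= lebesgue_outer_measure A.
Proof.
apply: le_ereal_inf_tmp => _ [D _ <-].
by apply: esum_ge0 => ab _; exact: box_volume_ge0.
Qed.

Lemma lebesgue_outer_measure0 : lebesgue_outer_measure set0 = 0.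
Proof.
apply/eqP; rewrite eq_le lebesgue_outer_measure_ge0 andbT.
by apply: ereal_inf_lbound; exists set0; [split|exact: esum_set0].
Qed.

Lemma le_lebesgue_outer_measure :
  {homo lebesgue_outer_measure : A B / A `<=` B >-> A <= B}.
Proof.
move=> A B AB; apply: ereal_inf_le_tmp => _ [D [cD BD] <-].
by exists D => //; split => //; exact: subset_trans BD.
Qed.

Lemma box_volume_bigcup (D : (set ('rV[R]_d * 'rV[R]_d))^nat) :
  \esum_(ab in \bigcup_n D n) box_volume ab <=
  \sum_(n <oo) \esum_(ab in D n) box_volume ab.
Proof.
rewrite seqDU_bigcup_eq nneseries_sum_bigcup //; last exact: box_volume_ge0.
apply: lee_nneseries => n _.
- by move=> _; apply: esum_ge0 => ab _; exact: box_volume_ge0.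
- rewrite esum_mkcond [leRHS]esum_mkcond; apply: le_esum => ab _.
  case: ifPn => [|_]; last by case: ifPn => // _; exact: box_volume_ge0.
  by rewrite inE => Dab; rewrite ifT// inE; exact: subset_seqDU Dab.
Qed.

Lemma lebesgue_outer_measure_sigma_subadditive :
  sigma_subadditive lebesgue_outer_measure.
Proof.
move=> A; have [[i ioo]|] :=
    pselect (exists i, lebesgue_outer_measure (A i) = +oo).
  rewrite (eseries_pinfty _ _ ioo) ?leey// => n _.
  by rewrite -ltNye (lt_le_trans _ (lebesgue_outer_measure_ge0 _)).
rewrite -forallNE => Aoo.
apply/lee_addgt0Pr => e e0.
apply: le_trans (epsilon_trick xpredT
  (fun n => lebesgue_outer_measure_ge0 (A n)) (ltW e0)).
have [D DA] : {D : (set ('rV[R]_d * 'rV[R]_d))^nat & forall n,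
    box_cover (A n) (D n) /\ \esum_(ab in D n) box_volume ab <=
      lebesgue_outer_measure (A n) + (e / (2 ^ n.+1)%:R)%:E}.
  apply: (@choice _ _ (fun n D => box_cover (A n) D /\
    \esum_(ab in D) box_volume ab <=
      lebesgue_outer_measure (A n) + (e / (2 ^ n.+1)%:R)%:E)) => n.
  have en0 : (0 < e / (2 ^ n.+1)%:R)%R by rewrite divr_gt0// ltr0n expn_gt0.
  have Afin : lebesgue_outer_measure (A n) \is a fin_num.
    rewrite ge0_fin_numE ?lebesgue_outer_measure_ge0//.
    by rewrite ltey; exact/eqP/Aoo.
  have [_ [D AD <-] /ltW DA] := lb_ereal_inf_adherent en0 Afin.
  by exists D.
apply: (@le_trans _ _ (\sum_(n <oo) \esum_(ab in D n) box_volume ab)).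
  apply: le_trans (box_volume_bigcup D).
  apply: ereal_inf_lbound; exists (\bigcup_n D n) => //; split.
    by apply: bigcup_countable => // n _; exact: (DA n).1.1.
  move=> x [n _ /(DA n).1.2[ab Dab abx]].
  by exists ab => //; exists n.
apply: lee_nneseries => n _.
- by move=> _; apply: esum_ge0 => ab _; exact: box_volume_ge0.
- exact: (DA n).2.
Qed.

HB.instance Definition _ := isOuterMeasure.Build R 'rV[R]_d
  lebesgue_outer_measure lebesgue_outer_measure0 lebesgue_outer_measure_ge0
  le_lebesgue_outer_measure lebesgue_outer_measure_sigma_subadditive.

End lebesgue_sigma_algebra.

(* R^d whose measurable sets are the Lebesgue measurable ones, i.e. the
   Caratheodory measurable sets of Lebesgue outer measure. *)
Notation lebesgue_space R d :=
  (caratheodory_type (@lebesgue_outer_measure R d)).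

Section estimators.
Context (R : realType) (d : nat) (dX : measure_display) (X : measurableType dX).
Context (Theta' : set 'rV[R]_d).

Definition estimator (g : X -> 'rV[R]_d) : Prop :=
  (forall x, Theta' (g x)) /\
  measurable_fun [set: X] (g : X -> lebesgue_space R d).

(* The expectation of a random vector is taken coordinatewise; it exists when
   all coordinates are integrable. *)
Definition unbiased (P : Theta' -> probability X R) (g : X -> 'rV[R]_d) : Prop :=
  forall (t : Theta') (i : 'I_d),
    (P t).-integrable [set: X] (fun x => (g x ord0 i)%:E) /\
    'E_(P t)[fun x => g x ord0 i] = (\val t ord0 i)%:E.

End estimators.

(* Main.v *)
Require Import Defs.
From HB Require Import structures.
From mathcomp Require Import all_boot all_order all_algebra.
From mathcomp Require Import all_classical all_reals all_analysis.
From mathcomp Require Import ring.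
Import Order.TTheory GRing.Theory Num.Theory.
Import numFieldNormedType.Exports.

Local Open Scope classical_set_scope.
Local Open Scope ring_scope.

(* Let c be a point of Theta' of maximal Euclidean norm.  The linear functional
   <c, c - .> is nonnegative on Theta' and vanishes there only at c.  Under P_c
   its composite with an unbiased estimator g has expectation <c, c - c> = 0, so
   g = c almost surely for P_c, hence for every P_t; taking expectations under
   P_t gives t = c, so Theta' is a singleton. *)

(** The index list is arbitrary to allow induction; the case used is the full enumeration of
    ['I_d]. *)
Lemma continuous_sum_sqr (R : realType) (d : nat) (s : seq 'I_d) :
  continuous (fun v : 'rV[R]_d => \sum_(i <- s) v ord0 i ^+ 2).
Proof.
elim: s => [|i s IHs].
  rewrite (_ : (fun _ => _) = cst 0); first exact: cst_continuous.
  by apply/funext => v; rewrite big_nil.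
pose f (v : 'rV[R]_d) := v ord0 i.
rewrite (_ : (fun _ => _) = f \* f +
  (fun v : 'rV[R]_d => \sum_(j <- s) v ord0 j ^+ 2)); last first.
  by apply/funext => v; rewrite big_cons.
move=> v; have fv : {for v, continuous f} by exact: coord_continuous.
exact: (continuousD (continuousM fv fv) (IHs v)).
Qed.

Lemma compact_max_sqr_norm (R : realType) (d : nat) (A : set 'rV[R]_d) :
  A !=set0 -> compact A ->
  exists2 c, A c & forall v, A v ->
    \sum_i v ord0 i ^+ 2 <= \sum_i c ord0 i ^+ 2.
Proof.
move=> A0 cA.
have [c /set_mem Ac cmax] := compact_EVT_max A0 cA
  (continuous_subspaceT (continuous_sum_sqr R d (index_enum 'I_d))).
by exists c => // v Av; apply/cmax/mem_set.
Qed.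

(** In each coordinate [2c(c - v) - (c - v)^2 = c^2 - v^2], so the gap between the two sides is the
    difference of the squared norms. *)
Lemma sqr_dist_le_dot (R : realDomainType) (d : nat) (c v : 'rV[R]_d) :
  \sum_i v ord0 i ^+ 2 <= \sum_i c ord0 i ^+ 2 ->
  \sum_i (c ord0 i - v ord0 i) ^+ 2 <=
    (\sum_i c ord0 i * (c ord0 i - v ord0 i)) *+ 2.
Proof.
move=> vc.
rewrite -subr_ge0 -sumrMnl -sumrB; rewrite -subr_ge0 -sumrB in vc.
by congr (0 <= _) : vc; apply: eq_bigr => i _; ring.
Qed.

Lemma dot_ge0 (R : realDomainType) (d : nat) (c v : 'rV[R]_d) :
  \sum_i v ord0 i ^+ 2 <= \sum_i c ord0 i ^+ 2 ->
  0 <= \sum_i c ord0 i * (c ord0 i - v ord0 i).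
Proof.
move=> /sqr_dist_le_dot cv.
rewrite -(pmulrn_lge0 _ (ltn0Sn 1)); apply: le_trans cv.
by apply: sumr_ge0 => i _; exact: sqr_ge0.
Qed.

(** The squared distance from [v] to [c] is then at most 0, so each of its terms vanishes. *)
Lemma dot_eq0 (R : realDomainType) (d : nat) (c v : 'rV[R]_d) :
  \sum_i v ord0 i ^+ 2 <= \sum_i c ord0 i ^+ 2 ->
  \sum_i c ord0 i * (c ord0 i - v ord0 i) = 0 -> v = c.
Proof.
move=> /sqr_dist_le_dot + cv0; rewrite cv0 mul0rn => le0.
have /psumr_eq0P dist0 : forall i : 'I_d, true ->
  0 <= (c ord0 i - v ord0 i) ^+ 2 by move=> i _; exact: sqr_ge0.
apply/rowP => i; apply/esym/eqP; rewrite -subr_eq0 -sqrf_eq0.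
apply/eqP/dist0 => //.
by apply/le_anti; rewrite le0 sumr_ge0// => j _; exact: sqr_ge0.
Qed.

(** Handles one coordinate of the functional: [a] stands for a coordinate of [c], both as
    coefficient and as mean of [f]. *)
Lemma expectation_mul_sub (R : realType) (dX : measure_display)
    (X : measurableType dX) (P : probability X R) (f : X -> R) (a : R) :
  P.-integrable [set: X] (EFin \o f) -> 'E_P[f]%E = a%:E ->
  P.-integrable [set: X] (fun x => (a * (a - f x))%:E) /\
  (\int[P]_x (a * (a - f x))%:E = 0)%E.
Proof.
move=> intf Ef.
have inta : P.-integrable [set: X] (EFin \o cst a).
  exact: finite_measure_integrable_cst.
have intaf := integrableB measurableT inta intf.
split; first exact: (integrableZl measurableT a intaf).
under eq_integral do rewrite EFinM EFinB.
have := expectation_cst P a; rewrite unlock in Ef * => Ea.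
rewrite integralZl// (integralB measurableT inta intf) Ef.
by rewrite Ea subee// mule0.
Qed.

Lemma estimator_ae_eq (R : realType) (d : nat) (Theta' : set 'rV[R]_d)
    (dX : measure_display) (X : measurableType dX)
    (P : Theta' -> probability X R) (g : X -> 'rV[R]_d) (c : Theta') :
  (forall x, Theta' (g x)) -> unbiased P g ->
  (forall v, Theta' v ->
    \sum_i v ord0 i ^+ 2 <= \sum_i val c ord0 i ^+ 2) ->
  ae_eq (P c) [set: X] g (cst (val c)).
Proof.
move=> gT ug cmax.
pose h i x := (val c ord0 i * (val c ord0 i - g x ord0 i))%:E.
have hE i : (P c).-integrable [set: X] (h i) /\ (\int[P c]_x h i x = 0)%E.
  by have [ig Eg] := ug c i; exact: expectation_mul_sub.
have inth : (P c).-integrable [set: X] (fun x => \sum_i h i x)%E.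
  by apply: integrable_sum => // i _; exact: (hE i).1.
(* Since [g] takes values in [Theta'], the integrand is nonnegative by maximality of [c]; the
   absolute value drops and the integral splits into coordinates, each contributing 0. *)
have : (\int[P c]_x `|\sum_i h i x| = 0)%E.
  under eq_integral => x _.
    rewrite gee0_abs; last by rewrite sumEFin lee_fin; apply/dot_ge0/cmax.
    over.
  rewrite integral_sum//; last by move=> i; exact: (hE i).1.
  by apply: big1 => i _; exact: (hE i).2.
move/(ae_eq_integral_abs (P c) measurableT (measurable_int _ inth)).
apply: filterS => x h0 _; apply: dot_eq0; first exact: cmax.
by have := h0 I; rewrite sumEFin => -[].
Qed.

Theorem theorem1 (R : realType) (d : nat) (Theta Theta' : set 'rV[R]_d)
    (dX : measure_display) (X : measurableType dX)
    (P : Theta' -> probability X R) :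
  Theta' `<=` Theta ->
  compact Theta' ->
  (forall t : 'rV[R]_d, Theta' <> [set t]) ->
  (forall t1 t2 : Theta', P t1 `<< P t2) ->
  ~ exists g : X -> 'rV[R]_d, estimator Theta' g /\ unbiased P g.
Proof.
move=> _ cT nT ac [g [[gT _] ug]].
(* [X] is pointed, so a value of [g] witnesses that [Theta'] is nonempty. *)
have [c Tc cmax] := compact_max_sqr_norm _ _ _
  (ex_intro _ (g point) (gT point)) cT.
apply: (nT c); apply/seteqP; split => [t Tt|_ ->//].
pose c' : Theta' := exist _ c (mem_set Tc).
pose t' : Theta' := exist _ t (mem_set Tt).
(* Null sets of [P c'] are null for [P t'], so [g = c] also holds almost surely under [P t']. *)
have gc := null_dominates_ae_eq measurableT (ac t' c')
  (estimator_ae_eq _ _ _ _ _ P g c' gT ug cmax).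
apply/rowP => i; have [intg Eg] := ug t' i; rewrite unlock in Eg.
(* Unbiasedness at [t'] turns [t ord0 i] into an integral of [g], whose integrand may be replaced by
   the constant [c ord0 i]. *)
apply: EFin_inj; rewrite -[LHS]Eg.
rewrite (ae_eq_integral (cst (c ord0 i)%:E))//.
- by rewrite integral_cst//= probability_setT mule1.
- exact: measurable_int intg.
- by apply: filterS gc => x /(_ I) -> _.
Qed.
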